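(* Let $\sigma,\tau\in G_n=\mathrm{Aut}_{K\text{-alg}}(\mathbb{S}_n)$. Then the following are equivalent: (1) $\sigma=\tau$; (2) $\sigma(x_i)=\tau(x_i)$ for all $i=1,\dots,n$; (3) $\sigma(y_i)=\tau(y_i)$ for all $i=1,\dots,n$.
   Context: $K$ is a field of characteristic zero and $n\ge1$. $\mathbb{S}_n$ is the $K$-algebra generated by $x_1,\dots,x_n,y_1,\dots,y_n$ subject to the defining relations $y_1x_1=\cdots=y_nx_n=1$ and $[x_i,y_j]=[x_i,x_j]=[y_i,y_j]=0$ for all $i\ne j$. *)

(* Defs.v *)
From HB Require Import structures.
From mathcomp Require Import all_boot all_order all_algebra.
Set Implicit Arguments. Unset Strict Implicit. Unset Printing Implicit Defensive.
Import GRing.Theory.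
Local Open Scope ring_scope.

Definition Sn_relations (K : fieldType) (n : nat) (B : algType K)
  (x y : 'I_n -> B) : Prop :=
  (forall i, y i * x i = 1) /\
  (forall i j, i != j ->
     [/\ x i * y j = y j * x i, x i * x j = x j * x i & y i * y j = y j * y i]).

(* (A, x, y) is a presentation of S_n: the relations hold, and it is the
   universal K-algebra with such generators (the K-algebra generated by
   x_i, y_i subject to the defining relations). *)
Definition is_Sn (K : fieldType) (n : nat) (A : algType K)
  (x y : 'I_n -> A) : Prop :=
  Sn_relations x y /\
  forall (B : algType K) (xb yb : 'I_n -> B), Sn_relations xb yb ->
    exists f : {lrmorphism A -> B},
      (forall i, f (x i) = xb i /\ f (y i) = yb i) /\
      forall g : {lrmorphism A -> B},
        (forall i, g (x i) = xb i /\ g (y i) = yb i) -> forall a, g a = f a.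

(* Main.v *)
(** Say y' are other one-sided inverses of the x_i such that x, y' generate
    S_n; it suffices to show y' = y.  The element e = prod_i (1 - x_i y_i)
    satisfies y_i e = 0 = e x_i, and S_n e = K[x] e is a faithful module, free
    of rank one over K[x].  Write y'_i e = q e with q in K[x] and let
    u = (1 - x_i y'_i) e = (1 - x_i q) e.  Then K[x] u is stable under x and
    y', hence is a left ideal of S_n, and it contains e = e u.  So 1 - x_i q is
    a unit of K[x], which forces q = 0: thus y'_i kills e, y'_i and y_i agree
    on K[x] e, and y'_i = y_i by faithfulness.  The hypotheses being symmetric
    under passing to the converse ring with x and y exchanged, the y_i
    determine the x_i as well.  That e is nonzero is seen on the action of S_n
    on formal power series. *)
Require Import Defs.
From HB Require Import structures.
From mathcomp Require Import all_boot all_order all_algebra.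
From mathcomp Require Import mpoly.
From mathcomp Require Import boolp functions.
Set Implicit Arguments. Unset Strict Implicit. Unset Printing Implicit Defensive.
Import GRing.Theory.
Local Open Scope ring_scope.

(** * Induction on monomials *)

Section Multinomials.
Variable n : nat.
Implicit Types (m : 'X_{1..n}) (i : 'I_n).

Lemma mnm_case m i : m i = 0%N \/ exists m', m = (U_(i) + m')%MM.
Proof.
have [->|mi] := eqVneq (m i) 0%N; [by left | right].
by exists (m - U_(i))%MM; rewrite addmC submK ?lep1mP.
Qed.

Lemma mnm_ind (P : 'X_{1..n} -> Prop) :
  P 0%MM -> (forall i m, P m -> P (U_(i) + m)%MM) -> forall m, P m.
Proof.
move=> P0 PS m; have [d] := ubnP (mdeg m); elim: d m => // d IHd m lt_md.
have [->|nz_m] := eqVneq m 0%MM; first by [].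
have [i mi] : exists i, m i != 0%N.
  apply/existsP; apply: contraR nz_m; rewrite negb_exists => /forallP m0.
  by apply/eqP/mnmP=> i; rewrite mnm0E; apply/eqP; have := m0 i; rewrite negbK.
have [mi0|[m' def_m]] := mnm_case m i; first by rewrite mi0 eqxx in mi.
rewrite def_m; apply/PS/IHd; move: lt_md.
by rewrite def_m mdegD mdeg1 add1n ltnS.
Qed.

End Multinomials.

(** Only additivity of [f] is assumed: below, [f] is itself an evaluation of polynomials, packaged
    just as an additive map. *)
Lemma mmap_monom (n : nat) (R : idomainType) (S : nzRingType) (f : {additive R -> S})
    (h : 'I_n -> S) (c : R) (m : 'X_{1..n}) :
  mmap f h (c *: 'X_[m]) = f c * mmap1 h m.
Proof.
have [->|nz_c] := eqVneq c 0; first by rewrite scale0r !raddf0 mul0r.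
rewrite /mmap (perm_big _ (msuppZ _ nz_c)) msuppX big_seq1.
by rewrite mcoeffZ mcoeffX eqxx mulr1.
Qed.

(* Scalars enter through a central morphism [iota] rather than an [algType]
   structure, so that the results also apply to the converse ring [A^c]. *)
Section OneSidedInverses.
Variables (K : fieldType) (A : nzRingType) (iota : {rmorphism K -> A}).
Hypothesis iotaC : forall c a, iota c * a = a * iota c.
Variable n : nat.
Implicit Types (x y : 'I_n -> A) (m : 'X_{1..n}) (p : {mpoly K[n]}).

Definition one_sided_relations x y : Prop :=
  (forall i, y i * x i = 1) /\
  (forall i j, i != j ->
     [/\ x i * y j = y j * x i, x i * x j = x j * x i & y i * y j = y j * y i]).

Inductive generated x y : A -> Prop :=
| gen_scalar c : generated x y (iota c)
| gen_x i : generated x y (x i)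
| gen_y i : generated x y (y i)
| gen_add a b : generated x y a -> generated x y b -> generated x y (a + b)
| gen_mul a b : generated x y a -> generated x y b -> generated x y (a * b).

(** * Monomials in a commuting family *)

Section CommutingFamily.
Variable z : 'I_n -> A.
Hypothesis zC : forall i j, z i * z j = z j * z i.

(** [mmap1] is an ordered product: [z i] travels past the powers of the earlier [z j] until it meets
    its own power. *)
Lemma mmap1_mulU i m : mmap1 z (U_(i) + m) = z i * mmap1 z m.
Proof.
rewrite /mmap1; have : i \in index_enum 'I_n by rewrite mem_index_enum.
elim: (index_enum 'I_n) (index_enum_uniq 'I_n) => // j r IHr /= /andP[jr r_uniq].
rewrite !big_cons inE mnmDE mnm1E; have [eij|ij /= ir] := eqVneq i j; last first.
  rewrite add0n IHr // !mulrA; congr (_ * _).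
  exact/commr_sym/commrX/zC.
rewrite -eij in jr *; rewrite add1n exprS -mulrA => _; congr (_ * (_ * _)).
apply: eq_big_seq => k kr; rewrite mnmDE mnm1E.
by rewrite eq_sym (negPf (memPn jr k kr)).
Qed.

End CommutingFamily.

Lemma mmap1_comm (z : 'I_n -> A) m a :
  (forall i, m i != 0%N -> a * z i = z i * a) -> a * mmap1 z m = mmap1 z m * a.
Proof.
move=> aC; rewrite /mmap1; apply: (big_ind (fun b => a * b = b * a)).
- by rewrite mulr1 mul1r.
- by move=> b c ab ac; rewrite mulrA ab -mulrA ac mulrA.
- move=> i _; have [->|/aC] := eqVneq (m i) 0%N; first by rewrite mulr1 mul1r.
  exact: commrX.
Qed.

(** * Polynomials in the x_i, orbits and normal ordering *)

Section Relations.
Variables x y : 'I_n -> A.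
Hypothesis xy : one_sided_relations x y.

Lemma rel_xC i j : x i * x j = x j * x i.
Proof. by have [->//|/xy.2[]] := eqVneq i j. Qed.

Lemma rel_yC i j : y i * y j = y j * y i.
Proof. by have [->//|/xy.2[]] := eqVneq i j. Qed.

Lemma rel_yx i : y i * x i = 1.
Proof. exact: xy.1. Qed.

Lemma rel_yxC i j : i != j -> y i * x j = x j * y i.
Proof. by rewrite eq_sym => /xy.2[]. Qed.

Lemma y_mmap1U i m : y i * mmap1 x (U_(i) + m) = mmap1 x m.
Proof. by rewrite (mmap1_mulU rel_xC) mulrA rel_yx mul1r. Qed.

Lemma y_mmap1C i m : m i = 0%N -> y i * mmap1 x m = mmap1 x m * y i.
Proof.
move=> mi; apply: mmap1_comm => j mj; apply: rel_yxC.
by apply: contraNneq mj => <-; rewrite mi.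
Qed.

Local Notation ev := (mmap iota x).

Lemma ev_Xmul m p : ev ('X_[m] * p) = mmap1 x m * ev p.
Proof.
elim/mpolyind: p => [|c k p _ _ IHp]; first by rewrite mulr0 !raddf0 mulr0.
rewrite mulrDr !mmapD mulrDr {}IHp; congr (_ + _).
rewrite -scalerAr -mpolyXD !mmapZ !mmapX [RHS]mulrA -iotaC -mulrA.
congr (_ * _); elim/mnm_ind: m => [|i m IHm]; first by rewrite mmap11 add0m mul1r.
by rewrite -addmA !(mmap1_mulU rel_xC) IHm mulrA.
Qed.

(** [A] need not be commutative; multiplicativity rests on the [x i] commuting with each other and
    with the scalars. *)
Lemma evM p q : ev (p * q) = ev p * ev q.
Proof.
elim/mpolyind: p => [|c m p _ _ IHp]; first by rewrite mul0r !raddf0 mul0r.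
by rewrite mulrDl !mmapD mulrDl IHp -scalerAl !mmapZ ev_Xmul mmapX mulrA.
Qed.

Lemma ev1 : ev 1 = 1.
Proof. by rewrite -mpolyC1 mmapC; exact: rmorph1. Qed.

Lemma ev_X i : ev 'X_i = x i.
Proof. by rewrite mmapX mmap1U. Qed.

(** Additivity in [p] and centrality of the scalars reduce the claim to monomials. Source [v] and
    target [w] may differ. *)
Lemma ev_orbit (v w : A) (a : A) :
  (forall m, exists p, a * (mmap1 x m * v) = ev p * w) ->
  forall p, exists q, a * (ev p * v) = ev q * w.
Proof.
move=> aP; elim/mpolyind=> [|c m p _ _ [q def_q]].
  by exists 0; rewrite !raddf0 !mul0r mulr0.
have [q' def_q'] := aP m; exists (c *: q' + q).
rewrite !mmapD !mmapZ mmapX !mulrDl mulrDr def_q; congr (_ + _).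
by rewrite -!mulrA -def_q' !mulrA iotaC.
Qed.

(** K[x] v is always stable under the scalars and the [x i], so only the [y i] have to be tested. *)
Lemma generated_orbit (v : A) :
  (forall i m, exists p, y i * (mmap1 x m * v) = ev p * v) ->
  forall a, generated x y a -> forall p, exists q, a * (ev p * v) = ev q * v.
Proof.
move=> yP a; elim=> {a} [c|i|i|a b _ IHa _ IHb|a b _ IHa _ IHb] p.
- by exists (c *: p); rewrite mmapZ mulrA.
- by exists ('X_i * p); rewrite evM ev_X mulrA.
- exact: ev_orbit.
- have [[q def_q] [r def_r]] := (IHa p, IHb p).
  by exists (q + r); rewrite mmapD !mulrDl def_q def_r.
- have [q def_q] := IHb p; have [r def_r] := IHa q.
  by exists r; rewrite -mulrA def_q.
Qed.

Local Notation normal := (mmap ev y).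

(** [normal q] is a sum of terms q_k(x) y^k. Such sums are stable under left multiplication by
    [y i], which either cancels a factor [x i] of x^m or, when there is none, moves past x^m to join
    y^k. *)
Lemma generated_normal a : generated x y a -> exists q, a = normal q.
Proof.
suff lmul : generated x y a -> forall q, exists r, a * normal q = normal r.
  move=> /lmul/(_ 1)[r def_r]; exists r.
  by rewrite -def_r -[X in normal X]mpolyC1 mmapC /= ev1 mulr1.
(* Reduction to the products x^m y^k: first by additivity in [q], then in each of its
   coefficients. *)
have ext b : (forall m k, exists c l,
    b * (mmap1 x m * mmap1 y k) = ev c * mmap1 y l) ->
  forall q, exists r, b * normal q = normal r.
  move=> bP; elim/mpolyind=> [|C k q _ _ [r def_r]].
    by exists 0; rewrite !raddf0 mulr0.
  suff [s def_s] : exists s, b * normal (C *: 'X_[k]) = normal s.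
    by exists (s + r); rewrite !raddfD mulrDr def_s def_r.
  elim/mpolyind: C => [|c m C _ _ [s def_s]].
    by exists 0; rewrite scale0r !raddf0 mulr0.
  have [c' [l def_l]] := bP m k; exists ((c *: c') *: 'X_[l] + s).
  rewrite scalerDl !raddfD mulrDr /= def_s; congr (_ + _).
  rewrite !mmap_monom /= mmap_monom mmapZ -!mulrA -def_l [RHS]mulrA [iota c * b]iotaC.
  by rewrite -!mulrA.
elim=> {a} [c|i|i|a b _ IHa _ IHb|a b _ IHa _ IHb].
- by apply: ext => m k; exists (c *: 'X_[m]), k; rewrite mmap_monom mulrA.
- apply: ext => m k; exists 'X_[U_(i) + m], k.
  by rewrite mmapX (mmap1_mulU rel_xC) mulrA.
- apply: ext => m k; have [mi|[m' ->]] := mnm_case m i.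
    exists 'X_[m], (U_(i) + k)%MM.
    by rewrite mmapX (mmap1_mulU rel_yC) mulrA y_mmap1C // mulrA.
  by exists 'X_[m'], k; rewrite mmapX mulrA y_mmap1U.
- move=> q; have [[r def_r] [s def_s]] := (IHa q, IHb q).
  by exists (r + s); rewrite raddfD mulrDl def_r def_s.
- move=> q; have [r def_r] := IHb q; have [s def_s] := IHa r.
  by exists s; rewrite -mulrA def_r.
Qed.

(** * The free faithful module K[x] e *)

Section Vacuum.
Variable e : A.
Hypothesis ye : forall i, y i * e = 0.

Lemma y_mmap1_vac i m :
  y i * (mmap1 x m * e) = if m i == 0%N then 0 else mmap1 x (m - U_(i)) * e.
Proof.
have [mi|[m' ->]] := mnm_case m i.
  by rewrite mi eqxx mulrA y_mmap1C // -mulrA ye mulr0.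
rewrite mnmDE mnm1E eqxx /= mulrA y_mmap1U; congr (mmap1 x _ * e).
by rewrite addmC addmK.
Qed.

Lemma ys_mmap1_vac m k :
  mmap1 y m * (mmap1 x k * e) =
    if (m <= k)%MM then mmap1 x (k - m) * e else 0.
Proof.
elim/mnm_ind: m => [|i m IHm].
  by rewrite mmap11 mul1r subm0 ifT //; apply/mnm_lepP => j; rewrite mnm0E.
rewrite (mmap1_mulU rel_yC) -mulrA IHm.
have [le_mk|nle_mk] := boolP (m <= k)%MM; last first.
  by rewrite mulr0 ifN //; apply: contra nle_mk; apply/lepm_trans/lem_addl.
rewrite y_mmap1_vac mnmBE subn_eq0 submDA addmC; case: (leqP (k i)) => [le_ki|lt_ik].
  rewrite ifN //; apply/negP=> /mnm_lepP/(_ i).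
  by rewrite mnmDE mnm1E eqxx add1n ltnNge le_ki.
rewrite ifT //; apply/mnm_lepP=> j; rewrite mnmDE mnm1E.
case: eqP => [<-|_]; first by rewrite add1n.
by rewrite add0n (mnm_lepP le_mk).
Qed.

(** On the monomials x^m e each [y i] lowers an exponent or gives 0, so K[x] e is a left ideal when
    [A] is generated. *)
Lemma generated_vac a : generated x y a -> exists p, a * e = ev p * e.
Proof.
move=> gen_a; have /(_ _ gen_a 1)[] := @generated_orbit e _ a.
  move=> i m; rewrite y_mmap1_vac; case: eqP => _; last first.
    by exists 'X_[m - U_(i)]; rewrite mmapX.
  by exists 0; rewrite raddf0 mul0r.
by rewrite ev1 mul1r => q ->; exists q.
Qed.

Hypothesis ex : forall i, e * x i = 0.
Hypothesis ee : e * e = e.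
Hypothesis e_neq0 : e != 0.

Lemma vac_mmap1 m : e * (mmap1 x m * e) = if m == 0%MM then e else 0.
Proof.
elim/mnm_ind: m => [|i m _]; first by rewrite eqxx mmap11 mul1r.
by rewrite mnmD_eq0 mnm1_eq0 /= (mmap1_mulU rel_xC) !mulrA ex !mul0r.
Qed.

(** y^m kills x^k e unless x^m divides x^k, and the left factor [e] kills every quotient x^(k-m)
    other than 1; only the term k = m survives. *)
Lemma vac_coef p m : e * (mmap1 y m * (ev p * e)) = iota p@_m * e.
Proof.
elim/mpolyind: p => [|c k p _ _ IHp].
  by rewrite raddf0 mcoeff0 raddf0 !(mul0r, mulr0).
rewrite mmapD mcoeffD rmorphD /= !mulrDl !mulrDr IHp; congr (_ + _).
rewrite mmapZ mmapX mcoeffZ mcoeffX -mulrA [mmap1 y m * _]mulrA -iotaC.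
rewrite -[iota c * _ * _]mulrA mulrA -iotaC -mulrA ys_mmap1_vac.
rewrite rmorphM -mulrA; congr (_ * _).
have [le_mk|nle_mk] := boolP (m <= k)%MM; last first.
  rewrite mulr0; case: eqP => [eq_km|_]; last by rewrite rmorph0 mul0r.
  by rewrite eq_km lepm_refl in nle_mk.
rewrite vac_mmap1 -(eqm_add2r m) submK // add0m.
by case: eqP => _; rewrite ?rmorph1 ?rmorph0 ?mul1r ?mul0r.
Qed.

Lemma vac_free p : ev p * e = 0 -> p = 0.
Proof.
move=> pe0; apply/mpolyP => m; rewrite mcoeff0.
apply: contraNeq e_neq0 => pm; rewrite -[e]mul1r -(rmorph1 iota) -(mulVf pm).
by rewrite rmorphM -mulrA -vac_coef pe0 !mulr0.
Qed.

Lemma vac_inj p q : ev p * e = ev q * e -> p = q.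
Proof.
by move=> epq; apply/eqP; rewrite -subr_eq0; apply/eqP/vac_free;
   rewrite mmapB mulrBl epq subrr.
Qed.

(* If [q_k] is a nonzero coefficient of minimal degree of the normal form
   [\sum_k q_k(x) y^k], then this element sends [x^k e] to [q_k(x) e]. *)
Lemma vac_faithful a :
  generated x y a -> (forall m, a * (mmap1 x m * e) = 0) -> a = 0.
Proof.
move=> /generated_normal[q ->] q0; suff -> : q = 0 by rewrite raddf0.
apply/mpolyP=> k; rewrite mcoeff0; have [d] := ubnP (mdeg k).
elim: d k => // d IHd k /ltnSE-le_kd; have := q0 k.
have [/memN_msupp_eq0 //|qk] := boolP (k \notin msupp q).
rewrite negbK in qk.
have -> : normal q = \sum_(m <- msupp q) ev q@_m * mmap1 y m by [].
rewrite mulr_suml (bigD1_seq k) ?msupp_uniq //=.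
have subkk : (k - k = 0)%MM by apply/mnmP=> i; rewrite mnmBE mnm0E subnn.
rewrite -mulrA ys_mmap1_vac lepm_refl subkk mmap11 mul1r.
rewrite big1 ?addr0 => [|m ne_mk]; first exact: vac_free.
rewrite -mulrA ys_mmap1_vac; case: ifP => [le_mk|_]; last by rewrite mulr0.
rewrite IHd ?raddf0 ?mul0r //; apply: leq_trans le_kd.
move: ne_mk; rewrite -{1 2}(submK le_mk) mdegD => ne_mk.
by rewrite -[ltnLHS]add0n ltn_add2r lt0n mdeg_eq0; apply: contraNneq ne_mk => ->;
   rewrite add0m.
Qed.

End Vacuum.
End Relations.

(** * Uniqueness of the one-sided inverses *)

Lemma one_sided_inverse_vac x y y' e :
    one_sided_relations x y -> (forall a, generated x y a) ->
    (forall i, y i * e = 0) -> (forall i, e * x i = 0) -> e * e = e -> e != 0 ->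
    one_sided_relations x y' -> (forall a, generated x y' a) ->
  forall i, y' i * e = 0.
Proof.
move=> xy gen ye ex ee e_neq0 xy' gen' i.
have [q def_q] := generated_vac xy ye (gen (y' i)).
pose u := e - x i * y' i * e.
have def_u : u = mmap iota x (1 - 'X_i * q) * e.
  by rewrite /u mmapB (ev1 x) (evM xy) ev_X mulrBl mul1r -!mulrA -def_q.
(* 1 - x_i y'_i annihilates every left multiple of [x i], because y'_i x_i = 1. *)
have xiu m : m i != 0%N -> (1 - x i * y' i) * (mmap1 x m * e) = 0.
  have [->//|[k ->] _] := mnm_case m i.
  rewrite (mmap1_mulU (rel_xC xy)) mulrA mulrA mulrBl mul1r.
  by rewrite -[x i * y' i * x i]mulrA (rel_yx xy') mulr1 subrr !mul0r.
(* If x_j divides x^m, then y'_j cancels it; otherwise y'_j reaches [u], and y'_i u = 0 settles j =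
   i. *)
have stable j m : exists p, y' j * (mmap1 x m * u) = mmap iota x p * u.
  have [mj|[k ->]] := mnm_case m j; last first.
    by exists 'X_[k]; rewrite mulrA (y_mmap1U xy') mmapX.
  rewrite mulrA (y_mmap1C xy') // -mulrA.
  have [<-|ne_ij] := eqVneq i j.
    exists 0; rewrite raddf0 mul0r /u mulrBr !mulrA (rel_yx xy') mul1r subrr.
    by rewrite mulr0.
  have [r def_r] := generated_vac xy ye (gen (y' j)).
  suff [s def_s] : exists s, y' j * u = mmap iota x s * u.
    by exists ('X_[m] * s); rewrite (evM xy) mmapX def_s mulrA.
  (* For j different from i, y'_j commutes with 1 - x_i y'_i and then acts on [e] as the polynomial
     [r]. *)
  have -> : y' j * u = (1 - x i * y' i) * (mmap iota x r * e).
    rewrite -def_r /u mulrBr mulrBl mul1r !mulrA (rel_yxC xy') 1?eq_sym //.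
    by rewrite -[x i * y' j * _]mulrA (rel_yC xy' j i) !mulrA.
  (* 1 - x_i y'_i commutes with monomials free of [x i], sending x^k e to x^k u; it kills the
     others. *)
  apply: ev_orbit => k; have [ki|/xiu ->] := eqVneq (k i) 0%N.
    exists 'X_[k]; rewrite mmapX /u mulrBl mul1r mulrBr; congr (_ - _).
    by rewrite !mulrA -(mulrA (x i)) (y_mmap1C xy') // !mulrA
               (mmap1_comm (fun j _ => rel_xC xy i j)).
  by exists 0; rewrite raddf0 mul0r.
have eu : e * u = e by rewrite /u mulrBr ee !mulrA ex !mul0r subr0.
(* [e] is also a combination of products of the [x j] and [y' j], so e = e u lies in K[x] u. *)
have [p def_p] := generated_orbit xy' stable (gen' e) 1.
have : p * (1 - 'X_i * q) = 1.
  apply: (vac_inj xy ye ex ee e_neq0).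
  by rewrite (evM xy) -mulrA -def_u -def_p (ev1 x) !mul1r.
(* A unit of K[x] is constant, and the coefficient of [q] at [m] is that of X_i q at the nonzero
   exponent U_i + m. *)
move=> /mpoly_intro_unit/andP[/eqP def_c _].
suff q0 : q = 0 by rewrite def_q q0 raddf0 mul0r.
apply/mpolyP=> m; rewrite mcoeff0 -(mcoeffMX q U_(i)) mulrC.
rewrite -(subKr 1 ('X_i * q)) def_c mcoeffB mcoeff1 mcoeffC.
by rewrite mnmD_eq0 mnm1_eq0 mulr0 subr0.
Qed.

Lemma one_sided_inverse_unique x y y' e :
    one_sided_relations x y -> (forall a, generated x y a) ->
    (forall i, y i * e = 0) -> (forall i, e * x i = 0) -> e * e = e -> e != 0 ->
    one_sided_relations x y' -> (forall a, generated x y' a) ->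
  forall i, y i = y' i.
Proof.
move=> xy gen ye ex ee e_neq0 xy' gen' i.
have y'e := one_sided_inverse_vac xy gen ye ex ee e_neq0 xy' gen'.
apply/eqP; rewrite -subr_eq0; apply/eqP.
(* The action on x^m e follows from the relations and from killing [e], hence is the same for y_i
   and y'_i. *)
apply: (vac_faithful xy ye ex ee e_neq0 (gen _)) => m.
by rewrite mulrBl (y_mmap1_vac xy) // (y_mmap1_vac xy') // subrr.
Qed.

End OneSidedInverses.

(** * The vacuum idempotent *)

Section Vacuum.
Variables (A : nzRingType) (n : nat) (x y : 'I_n -> A).
Hypothesis xy : one_sided_relations x y.

Definition vacuum : A := \prod_(i < n) (1 - x i * y i).

Lemma y_vacuum i : y i * vacuum = 0.
Proof.
rewrite /vacuum; have : i \in index_enum 'I_n by rewrite mem_index_enum.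
elim: (index_enum 'I_n) => // j r IHr; rewrite big_cons inE mulrA.
case: eqVneq => [<- _|ne_ij /= /IHr yr0].
  by rewrite mulrBr mulr1 mulrA xy.1 mul1r subrr mul0r.
suff -> : y i * (1 - x j * y j) = (1 - x j * y j) * y i by rewrite -mulrA yr0 mulr0.
rewrite mulrBl mulrBr mulr1 mul1r mulrA (rel_yxC xy) //.
by rewrite -!mulrA (rel_yC xy).
Qed.

Lemma vacuum_x i : vacuum * x i = 0.
Proof.
rewrite /vacuum; have : i \in index_enum 'I_n by rewrite mem_index_enum.
elim: (index_enum 'I_n) (index_enum_uniq 'I_n) => // j r IHr /= /andP[jr r_uniq].
rewrite big_cons inE -mulrA; case: eqVneq => [eij _|_ /= /IHr->//]; last first.
  by rewrite mulr0.
(* [x i] crosses the factors to the right of the i-th one, whose indices all differ from i, and is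
   then killed by 1 - x_i y_i. *)
suff <- : x i * \prod_(k <- r) (1 - x k * y k) = \prod_(k <- r) (1 - x k * y k) * x i.
  by rewrite mulrA mulrBl mul1r eij -mulrA xy.1 mulr1 subrr mul0r.
rewrite -eij in jr; elim: r jr {IHr r_uniq} => [|k r IHr]; first by rewrite big_nil mulr1 mul1r.
rewrite inE big_cons negb_or => /andP[ne_ik /IHr xr].
rewrite -[RHS]mulrA -xr !mulrA; congr (_ * _).
rewrite mulrBl mulrBr mulr1 mul1r -[in RHS]mulrA (rel_yxC xy) 1?eq_sym //.
by rewrite !mulrA (rel_xC xy).
Qed.

Lemma vacuum_idem : vacuum * vacuum = vacuum.
Proof.
rewrite {2}/vacuum; apply: (big_ind (fun b => vacuum * b = vacuum)).
- exact: mulr1.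
- by move=> b c vb vc; rewrite mulrA vb.
- by move=> i _; rewrite mulrBr mulr1 mulrA vacuum_x mul0r subr0.
Qed.

End Vacuum.

(** * A concrete representation on formal power series *)

(* [u m] is the coefficient of ['X^m] in the power series [u]. *)
Section PowerSeriesOperators.
Variables (K : fieldType) (n : nat).
Local Notation series := ('X_{1..n} -> K^o).
Implicit Types (f g h : series -> series) (u v : series).

Definition linear_pred : {pred series -> series} := fun f => `[< linear f >].

Lemma linear_predP f : reflect (linear f) (f \in linear_pred).
Proof. exact: asboolP. Qed.

Lemma linear_pred_submod : submod_closed linear_pred.
Proof.
split=> [|c f g /linear_predP fL /linear_predP gL]; apply/linear_predP => a u v.
  by rewrite scaler0 addr0.
have ptE w : (c *: f + g) w = c *: f w + g w by [].
by rewrite !ptE fL gL !scalerDr addrACA !scalerA mulrC.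
Qed.
HB.instance Definition _ :=
  GRing.isSubmodClosed.Build K (series -> series) linear_pred linear_pred_submod.

(** The endomorphism algebra of the space of power series, made a K-algebra so that the universal
    property can map into it. *)
Record operator := Operator
  { operator_fun :> series -> series; _ : operator_fun \in linear_pred }.
HB.instance Definition _ := [isSub for operator_fun].
HB.instance Definition _ := [Choice of operator by <:].
HB.instance Definition _ := [SubChoice_isSubLmodule of operator by <:].
Implicit Types F G H : operator.

Lemma operator_linear F : linear F.
Proof. by apply/linear_predP; case: F. Qed.

Lemma operatorP F G : (forall u, F u = G u) -> F = G.
Proof. by move=> eqFG; apply/val_inj/funext. Qed.

Lemma comp_linear_pred F G : F \o G \in linear_pred.
Proof. by apply/linear_predP => a u v /=; rewrite !operator_linear. Qed.

Lemma id_linear_pred : idfun \in linear_pred.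
Proof. by apply/linear_predP. Qed.

Definition operator_mul F G := Operator (comp_linear_pred F G).
Definition operator_one := Operator id_linear_pred.

Lemma operator_mulA : associative operator_mul.
Proof. by move=> F G H; apply: operatorP. Qed.

Lemma operator_mul1F : left_id operator_one operator_mul.
Proof. by move=> F; apply: operatorP. Qed.

Lemma operator_mulF1 : right_id operator_one operator_mul.
Proof. by move=> F; apply: operatorP. Qed.

Lemma operator_mulDl : left_distributive operator_mul +%R.
Proof. by move=> F G H; apply: operatorP. Qed.

Lemma operator_mulDr : right_distributive operator_mul +%R.
Proof.
move=> F G H; apply: operatorP => u.
by have := operator_linear F 1 (G u) (H u); rewrite !scale1r.
Qed.

Lemma operator_one_neq0 : operator_one != 0.
Proof.
apply/eqP => /(congr1 (fun F : operator => F 1 0%MM)) /eqP.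
by rewrite (negPf (oner_neq0 K)).
Qed.

HB.instance Definition _ := GRing.Zmodule_isNzRing.Build operator operator_mulA
  operator_mul1F operator_mulF1 operator_mulDl operator_mulDr operator_one_neq0.

Lemma operator_scalerAl (a : K) F G : a *: (F * G) = (a *: F) * G.
Proof. exact: operatorP. Qed.
HB.instance Definition _ := GRing.Lmodule_isLalgebra.Build K operator operator_scalerAl.

Lemma operator_scalerAr (a : K) F G : a *: (F * G) = F * (a *: G).
Proof.
apply: operatorP => u; have := operator_linear F a (G u) 0.
have -> : F 0 = 0 by have := operator_linear F (-1) 0 0; rewrite !scaleN1r !addNr.
by rewrite !addr0 => FZ; exact: esym FZ.
Qed.
HB.instance Definition _ := GRing.Lalgebra_isAlgebra.Build K operator operator_scalerAr.

(** Multiplication by X_i; the test is needed because subtraction of exponents is truncated. *)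
Definition mulX_fun i u : series :=
  fun m => if m i == 0%N then 0 else u (m - U_(i))%MM.
(** Division by X_i after discarding the terms not divisible by X_i. *)
Definition divX_fun i u : series := fun m => u (U_(i) + m)%MM.

Lemma mulX_linear i : mulX_fun i \in linear_pred.
Proof.
apply/linear_predP => a u v; apply/funext => m.
by rewrite /mulX_fun !fctE; case: ifP; rewrite // scaler0 addr0.
Qed.

Lemma divX_linear i : divX_fun i \in linear_pred.
Proof. by apply/linear_predP. Qed.

Definition mulX i := Operator (mulX_linear i).
Definition divX i := Operator (divX_linear i).

Lemma mulX_divX_relations : Sn_relations mulX divX.
Proof.
split=> [i|i j ne_ij].
  apply: operatorP => u; apply/funext => m /=.
  by rewrite /divX_fun /mulX_fun mnmDE mnm1E eqxx addmC addmK.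
have Uij : U_(i)%MM j = 0%N by rewrite mnm1E (negPf ne_ij).
have Uji : U_(j)%MM i = 0%N by rewrite mnm1E eq_sym (negPf ne_ij).
split; apply: operatorP => u; apply/funext => m /=; rewrite /mulX_fun /divX_fun.
- rewrite mnmDE Uji add0n; case: eqVneq => // mi.
  by rewrite addmBA // lep1mP.
- rewrite !mnmBE Uij Uji !subn0 !submDA addmC.
  by case: (m i == 0%N); case: (m j == 0%N).
- by rewrite !addmA [(U_(i) + _)%MM]addmC.
Qed.

Lemma vacuum_mulX_divX_neq0 : vacuum mulX divX != 0.
Proof.
(* The argument [1] is the pointwise unit, the series with all coefficients 1. Each factor 1 - x_i
   y_i preserves constant coefficients. *)
suff : vacuum mulX divX 1 0%MM = 1.
  by move=> v1; apply/eqP => v0; move/eqP: v1; rewrite v0 eq_sym oner_eq0.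
apply: (big_ind (fun F : operator => forall u, F u 0%MM = u 0%MM)) => //.
  by move=> F G F0 G0 u /=; rewrite [LHS]F0.
move=> i _ u; rewrite -[RHS]subr0; congr (_ - _).
by rewrite /= /mulX_fun mnm0E.
Qed.

End PowerSeriesOperators.

(** * Generation from the universal property *)

Section Generation.
Variables (K : fieldType) (n : nat) (A : algType K) (x y : 'I_n -> A).

Definition gen_pred : {pred A} := fun a => `[< generated (in_alg A) x y a >].

Lemma gen_predP a : reflect (generated (in_alg A) x y a) (a \in gen_pred).
Proof. exact: asboolP. Qed.

Lemma gen_pred_subalg : subalg_closed gen_pred.
Proof.
split=> [|c a b /gen_predP aP /gen_predP bP|a b /gen_predP aP /gen_predP bP].
- by apply/gen_predP; rewrite -(rmorph1 (in_alg A)); apply: gen_scalar.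
- apply/gen_predP; rewrite -[a]mul1r scalerAl.
  by apply/gen_add => //; apply/gen_mul => //; apply: gen_scalar.
- by apply/gen_predP/gen_mul.
Qed.
HB.instance Definition _ := GRing.isSubalgClosed.Build K A gen_pred gen_pred_subalg.

Record gen_subalg := GenSubalg { gen_val : A; _ : gen_val \in gen_pred }.
HB.instance Definition _ := [isSub for gen_val].
HB.instance Definition _ := [Choice of gen_subalg by <:].
HB.instance Definition _ := [SubChoice_isSubAlgebra of gen_subalg by <:].

Lemma gen_val_linear : linear gen_val. Proof. by []. Qed.
Lemma gen_val_multiplicative : monoid_morphism gen_val. Proof. by []. Qed.
HB.instance Definition _ :=
  GRing.isLinear.Build K gen_subalg A *:%R gen_val gen_val_linear.
HB.instance Definition _ :=
  GRing.isMonoidMorphism.Build gen_subalg A gen_val gen_val_multiplicative.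

(** The universal map into the generated subalgebra, followed by inclusion, fixes the generators,
    hence is the identity by uniqueness. *)
Lemma is_Sn_generated : is_Sn x y -> forall a, generated (in_alg A) x y a.
Proof.
move=> [xy univ] a.
have xP i : x i \in gen_pred by apply/gen_predP/gen_x.
have yP i : y i \in gen_pred by apply/gen_predP/gen_y.
pose xB i := GenSubalg (xP i); pose yB i := GenSubalg (yP i).
have xyB : Sn_relations xB yB.
  split=> [i|i j ne_ij]; first by apply: val_inj; rewrite rmorphM rmorph1 /= xy.1.
  have [xyC xC yC] := xy.2 i j ne_ij.
  by split; apply: val_inj; rewrite !rmorphM.
have [[f [fxy _]] [g [_ g_uniq]]] := (univ _ xB yB xyB, univ A x y xy).
have def_a : val (f a) = a.
  rewrite -[RHS]/(idfun a) (g_uniq idfun) //.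
  by apply: (g_uniq (gen_val \o f)) => i /=; rewrite (fxy i).1 (fxy i).2.
by rewrite -def_a; apply/gen_predP/valP.
Qed.
End Generation.

(** * Exchange of x and y in the converse ring *)

Section Converse.
Variables (K : fieldType) (A : algType K).

Definition conv_in_alg (c : K) : A^c := c%:A.

Lemma conv_in_alg_additive : zmod_morphism conv_in_alg.
Proof. by move=> c d; apply: (rmorphB (in_alg A)). Qed.

Lemma conv_in_alg_multiplicative : monoid_morphism conv_in_alg.
Proof.
split=> [|c d]; first exact: (rmorph1 (in_alg A)).
(* Commutativity of [K] compensates for the reversed product. *)
by rewrite mulrC; apply: (rmorphM (in_alg A)).
Qed.
HB.instance Definition _ := GRing.isZmodMorphism.Build K A^c conv_in_alg conv_in_alg_additive.
HB.instance Definition _ :=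
  GRing.isMonoidMorphism.Build K A^c conv_in_alg conv_in_alg_multiplicative.

Lemma in_algC (c : K) (a : A) : in_alg A c * a = a * in_alg A c.
Proof. by rewrite /= -scalerAl mul1r -scalerAr mulr1. Qed.

Variables (n : nat) (x y : 'I_n -> A).

Lemma one_sided_relations_conv :
  one_sided_relations x y -> @one_sided_relations A^c n y x.
Proof.
move=> xy; split=> [i|i j ne_ij]; first exact: xy.1.
have [_ xC yC] := xy.2 i j ne_ij.
by split; [exact: esym (rel_yxC xy ne_ij) | exact: esym yC | exact: esym xC].
Qed.

Lemma generated_conv a :
  generated (in_alg A) x y a -> generated conv_in_alg y x (a : A^c).
Proof.
elim=> {a} [c|i|i|a b _ IHa _ IHb|a b _ IHa _ IHb].
- exact: (gen_scalar conv_in_alg).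
- exact: gen_y.
- exact: gen_x.
- exact: gen_add.
- exact: (@gen_mul _ _ conv_in_alg _ _ _ b a).
Qed.

End Converse.

(** * Transport of the presentation along automorphisms *)

Section Automorphisms.
Variables (K : fieldType) (n : nat) (A : algType K) (x y : 'I_n -> A).
Hypothesis hA : is_Sn x y.

(** The universal map to operators on power series sends this element to the vacuum there, which is
    nonzero. *)
Lemma vacuum_neq0 : vacuum x y != 0.
Proof.
have [f [fxy _]] := hA.2 (operator K n) _ _ (mulX_divX_relations K n).
apply: contraNneq (vacuum_mulX_divX_neq0 K n) => /(congr1 f).
rewrite rmorph0 rmorph_prod => <-; apply/eqP/eq_bigr => i _.
by rewrite rmorphB rmorphM rmorph1 /= (fxy i).1 (fxy i).2.
Qed.

Variable sigma : {lrmorphism A -> A}.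

Lemma one_sided_relations_morph :
  one_sided_relations (sigma \o x) (sigma \o y).
Proof.
have [[yx xyC] _] := hA.
split=> [i|i j /xyC[xy xx yy]]; first by rewrite /= -rmorphM yx rmorph1.
by rewrite /= -!rmorphM xy xx yy.
Qed.

Hypothesis sigma_bij : bijective sigma.

(** By surjectivity [a] is the image of an element expressed in the [x i] and [y i]; [sigma] carries
    that expression over. *)
Lemma generated_aut a :
  generated (in_alg A) (sigma \o x) (sigma \o y) a.
Proof.
have [sigma' _ sigmaK] := sigma_bij; rewrite -(sigmaK a).
elim: (is_Sn_generated hA (sigma' a)) => {a} [c|i|i|a b _ IHa _ IHb|a b _ IHa _ IHb].
- by rewrite /= linearZ rmorph1; apply: (gen_scalar (in_alg A)).
- exact: (@gen_x _ _ (in_alg A) _ (sigma \o x)).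
- exact: (@gen_y _ _ (in_alg A) _ (sigma \o x) (sigma \o y)).
- by rewrite rmorphD; apply: gen_add.
- by rewrite rmorphM; apply: gen_mul.
Qed.

End Automorphisms.

(** * Comparison of two automorphisms *)

Section Rigidity.
Variables (K : fieldType) (n : nat) (A : algType K) (x y : 'I_n -> A).
Hypothesis hA : is_Sn x y.
Variables sigma tau : {lrmorphism A -> A}.
Hypotheses (hsig : bijective sigma) (htau : bijective tau).

Let xy := hA.1.
Let e := sigma (vacuum x y).

Let ye i : sigma (y i) * e = 0.
Proof. by rewrite -rmorphM y_vacuum ?rmorph0. Qed.

Let ex i : e * sigma (x i) = 0.
Proof. by rewrite -rmorphM vacuum_x ?rmorph0. Qed.

Let ee : e * e = e.
Proof. by rewrite -rmorphM vacuum_idem. Qed.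

Let e_neq0 : e != 0.
Proof.
apply: contraNneq (vacuum_neq0 hA) => e0.
by apply/eqP/(bij_inj hsig); rewrite rmorph0.
Qed.

Lemma aut_eq_y :
  (forall i, sigma (x i) = tau (x i)) -> forall i, sigma (y i) = tau (y i).
Proof.
move=> eqx; have eqX : sigma \o x = tau \o x by apply/funext.
apply: (one_sided_inverse_unique (@in_algC K A)
  (one_sided_relations_morph hA sigma) (generated_aut hA hsig) ye ex ee e_neq0
  (y' := tau \o y)); rewrite eqX.
  exact: one_sided_relations_morph.
exact: generated_aut.
Qed.

Lemma aut_eq_x :
  (forall i, sigma (y i) = tau (y i)) -> forall i, sigma (x i) = tau (x i).
Proof.
move=> eqy; have eqY : sigma \o y = tau \o y by apply/funext.
(* In [A^c] the families trade places, so [ex] and [ye] do too; [e] serves unchanged. *)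
apply: (@one_sided_inverse_unique K A^c (@conv_in_alg K A)
  (fun c a => esym (in_algC c a)) n (sigma \o y) (sigma \o x) (tau \o x) e
  (one_sided_relations_conv (one_sided_relations_morph hA sigma))
  (fun a => generated_conv (generated_aut hA hsig a)) ex ye ee e_neq0).
  by rewrite eqY; apply/one_sided_relations_conv/one_sided_relations_morph.
by move=> a; rewrite eqY; apply/generated_conv/generated_aut.
Qed.

Lemma aut_ext :
  (forall i, sigma (x i) = tau (x i)) -> (forall i, sigma (y i) = tau (y i)) ->
  sigma =1 tau.
Proof.
move=> eqx eqy a.
have [f [_ f_uniq]] := hA.2 A _ _ (one_sided_relations_morph hA tau).
by rewrite (f_uniq sigma) ?(f_uniq tau) // => i; rewrite eqx eqy.
Qed.

End Rigidity.

Theorem theorem3p6 (K : fieldType) (hK : [pchar K] =i pred0) (n : nat)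
  (hn : (1 <= n)%N) (A : algType K) (x y : 'I_n -> A) (hA : is_Sn x y)
  (sigma tau : {lrmorphism A -> A})
  (hsig : bijective sigma) (htau : bijective tau) :
  [/\ (sigma =1 tau) <-> (forall i, sigma (x i) = tau (x i)),
      (sigma =1 tau) <-> (forall i, sigma (y i) = tau (y i)) &
      (forall i, sigma (x i) = tau (x i)) <-> (forall i, sigma (y i) = tau (y i))].
Proof.
have xy := aut_eq_y hA hsig htau; have yx := aut_eq_x hA hsig htau.
split; split=> // eq_st.
- exact: aut_ext hA _ _ eq_st (xy eq_st).
- exact: aut_ext hA _ _ (yx eq_st) eq_st.
Qed.
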